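(* Let $K$ be a field, let $n,m\ge 1$, and let $f(X,Y)=\sum_{i=0}^{n}a_{i}Y^{i}$, $g(X,Y)=\sum_{i=0}^{m}b_{i}Y^{i}\in K[X,Y]$, with $a_{0},\dots,a_{n},b_{0},\dots,b_{m}\in K[X]$ and $a_{0}a_{n}b_{0}b_{m}\neq 0$. Assume that $f$ and $g$ have no nonconstant factors in $K[X]$. Let $$A=\deg a_0-\max\{\deg a_1,\dots,\deg a_n\},\qquad B=\max\{\deg b_0,\dots,\deg b_{m-1}\}-\deg b_m.$$ If $\min\{A,\frac{A}{n}\}>\max\{B,\frac{B}{m}\}$ and $\min\{\deg a_0,\deg b_m\}>\deg d$ for some divisor $d\in K[X]$ of $Res_Y(f,g)$, then each one of $f$ and $g$ is a product of at most $\Omega\left(\frac{Res_Y(f,g)}{d}\right)$ irreducible factors in $K[X,Y]$ (counting multiplicities).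
   Context: $Res_Y(f,g)\in K[X]$ is the resultant of $f$ and $g$ regarded as polynomials in $Y$ with coefficients in $K[X]$ (it is nonzero under the hypothesis $\min\{A,\frac{A}{n}\}>\max\{B,\frac{B}{m}\}$); $\deg$ is the degree in $X$, with $\deg 0=-\infty$. For a nonzero polynomial $h\in K[X]$, $\Omega(h)$ denotes the number of its irreducible factors in $K[X]$, counted with multiplicities (up to multiplication by nonzero constants). *)

(* Defs.v *)
From mathcomp Require Import all_boot all_order all_algebra.
From mathcomp Require Import boolp classical_sets.

Set Implicit Arguments.
Unset Strict Implicit.
Unset Printing Implicit Defensive.

Import Order.TTheory GRing.Theory Num.Theory.
Local Open Scope ring_scope.

(* K[X,Y] is {poly {poly K}}: the outer variable is Y, the inner one is X, so
   that [resultant f g : {poly K}] is the resultant with respect to Y. *)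

(* The value -1 at 0 stands for -oo: the order on degrees is the right one, and
   a maximum over a family with a nonzero member is the usual maximum. *)
Definition degX (K : fieldType) (p : {poly K}) : int := (size p)%:Z - 1.

(* Over {poly K} the division [%|] of polydiv is only a pseudo-division, so
   factors in K[X,Y] are expressed with honest products. *)
Definition no_nonconstant_factor_KX (K : fieldType) (f : {poly {poly K}}) :=
  forall (c : {poly K}) (q : {poly {poly K}}), f = c%:P * q -> (size c <= 1)%N.

(* [irreducible_poly] is not the irreducibility of elements of K[X,Y]: the
   coefficient ring K[X] is not a field. *)
Definition irreducible_elt (R : idomainType) (p : R) : Prop :=
  [/\ p != 0, p \isn't a GRing.unit &
      forall u v : R, p = u * v -> u \is a GRing.unit \/ v \is a GRing.unit].

Definition irreducible_decomp (K : fieldType) (h : {poly K})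
    (s : seq {poly K}) : Prop :=
  {in s, forall p, irreducible_poly p} /\ h %= \prod_(p <- s) p.

(* For h != 0 the integer k exists and is unique: see [OmegaE] and
   [irreducible_decomp_exists]. *)
Definition Omega (K : fieldType) (h : {poly K}) : nat :=
  xget 0%N [set k | exists2 s, irreducible_decomp h s & size s = k]%classic.

Lemma irreducible_decomp_exists (K : fieldType) (h : {poly K}) :
  h != 0 -> exists s, irreducible_decomp h s.
Proof.
have [n] := ubnP (size h); elim: n h => // n IHn h /ltnSE le_hn h0.
have [h1|h1] := leqP (size h) 1.
  exists [::]; split=> //; rewrite big_nil.
  by rewrite -size_poly_eq1 eqn_leq h1 lt0n size_poly_eq0.
have [irr_h|red_h] := pselect (irreducible_poly h).
  by exists [:: h]; split=> [p /[!inE]/eqP->//|]; rewrite big_seq1 eqpxx.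
have [q [q1 q_dv_h neq_qh]] : exists q : {poly K}, [/\ size q != 1, q %| h & ~~ (q %= h)].
  apply: contrapT => no_q; apply: red_h; split=> // q q1 qh.
  by apply: contrapT => /negP neq_qh; apply: no_q; exists q.
have q0 : q != 0 by apply: contraNneq h0 => q0; rewrite q0 dvd0p in q_dv_h.
have Eh : h = h %/ q * q by rewrite divpK.
have r0 : h %/ q != 0 by apply: contraNneq h0 => r0; rewrite Eh r0 mul0r.
have q_gt1 : (1 < size q)%N by rewrite ltn_neqAle eq_sym q1 lt0n size_poly_eq0.
have lt_qh : (size q < size h)%N.
  by rewrite ltn_neqAle dvdp_leq // andbT dvdp_size_eqp.
have lt_rh : (size (h %/ q)%R < size h)%N.
  by rewrite size_divp // ltn_subrL -subn1 subn_gt0 q_gt1 ltnW.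
have [s [irr_s Es]] := IHn _ (leq_trans lt_qh le_hn) q0.
have [t [irr_t Et]] := IHn _ (leq_trans lt_rh le_hn) r0.
exists (t ++ s); split=> [p|].
  by rewrite mem_cat => /orP[/irr_t|/irr_s].
by rewrite Eh big_cat /= (eqp_trans (eqp_mulr _ Et)) // eqp_mull.
Qed.

Lemma irreducible_decomp_uniq (K : fieldType) (h : {poly K}) s t :
  irreducible_decomp h s -> irreducible_decomp h t -> size s = size t.
Proof.
elim: s h t => [|p s IHs] h t [irr_s Es] [irr_t Et].
  case: t irr_t Et => //= q t irr_t Et.
  have [q_gt1 _] := irr_t q (mem_head _ _).
  rewrite big_nil in Es.
  have : q %| 1 by rewrite -(eqp_dvdr _ Es) (eqp_dvdr _ Et) big_cons dvdp_mulr.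
  by rewrite dvdp1 => /eqP q1; rewrite q1 in q_gt1.
have irr_p := irr_s p (mem_head _ _).
have p0 := irredp_neq0 irr_p.
have p1 : size p != 1%N by rewrite neq_ltn irr_p.1 orbT.
have p_dv_t : p %| \prod_(q <- t) q.
  by rewrite -(eqp_dvdr _ Et) (eqp_dvdr _ Es) big_cons dvdp_mulr.
have [q qt p_dv_q] : exists2 q, q \in t & p %| q.
  elim: t p_dv_t {irr_t Et} => [|q t IHt].
    by rewrite big_nil dvdp1 (negPf p1).
  rewrite big_cons => p_dv; have [p_dv_q|p_ndv_q] := boolP (p %| q).
    by exists q; rewrite ?mem_head.
  have co_pq : coprimep p q.
    rewrite /coprimep; apply: contraNT p_ndv_q => g1.
    by rewrite -(eqp_dvdl _ (irr_p.2 _ g1 (dvdp_gcdl _ _))) dvdp_gcdr.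
  rewrite Gauss_dvdpr // in p_dv; have [r rt p_dv_r] := IHt p_dv.
  by exists r; rewrite ?inE ?rt ?orbT.
have eq_pq : p %= q := (irr_t q qt).2 _ p1 p_dv_q.
rewrite (perm_size (perm_to_rem qt)) /=; congr _.+1.
apply: (IHs (\prod_(r <- s) r)); split.
- by move=> r rs; apply: irr_s; rewrite inE rs orbT.
- exact: eqpxx.
- by move=> r /mem_rem; apply: irr_t.
move: Es Et; rewrite (perm_big _ (perm_to_rem qt)) /= !big_cons => Es Et.
rewrite -(eqp_mul2l _ _ p0) -(eqp_ltrans Es) (eqp_ltrans Et).
by rewrite eqp_mulr // eqp_sym.
Qed.

Lemma OmegaE (K : fieldType) (h : {poly K}) s :
  irreducible_decomp h s -> Omega h = size s.
Proof.
move=> hs; rewrite /Omega; apply: xget_subset1; first by exists s.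
move=> _ _ [t ht <-] [u hu <-]; exact: irreducible_decomp_uniq ht hu.
Qed.

(* Main.v *)
Require Import Defs.
From mathcomp Require Import all_boot all_order all_algebra.
From mathcomp Require Import perm fraction.
From mathcomp Require Import lra.
From mathcomp Require boolp.
Import Order.TTheory GRing.Theory Num.Theory.
Local Open Scope ring_scope.
Set Implicit Arguments.
Unset Strict Implicit.
Unset Printing Implicit Defensive.

(** The hypothesis on [A] and [B] provides a rational slope [w] with
    [max B (B / m) < w < min A (A / n)].  Give the monomial [c * Y^i], with [c]
    in K[X], the weight [deg c + w * i].  For this weight the constant term of
    [f] strictly dominates all its other terms, and the leading term of [g]
    strictly dominates all its other terms; informally, every root of [f] in
    [Y] has degree larger than [w] and every root of [g] has degree smaller
    than [w].

    As in the theory of Newton polygons, the terms of maximal weight multiply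
    without cancellation at both ends, so a dominant term of a product comes
    from dominant terms of the factors ([dominant_factor]).  A factor [p] of
    [f] therefore has a dominant constant term and a factor [q] of [g] a
    dominant leading term.  In the Sylvester matrix of such a pair these
    dominant coefficients are exactly the diagonal entries, and the diagonal
    product has strictly larger degree than any other term of the Leibniz
    expansion ([det_dominant]).  Hence
    [deg Res(p, q) = deg_Y q * deg p_0 + deg_Y p * deg (lead q)]
    ([degX_resultant]): a factor of positive degree in [Y] of [f] has a
    resultant with [g] of degree at least [deg b_m], and similarly [deg a_0]
    bounds below the resultants of [f] with the factors of [g].

    Since [f] has no nonconstant factor in K[X], all its irreducible factors
    [p] have positive degree in [Y].  The resultant is multiplicative
    ([resultantMl], proved by identifying the resultant over a field with the
    determinant of the multiplication by [p] modulo [q]), so [Res(f, g)] is a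
    product of polynomials each of degree larger than [deg d].  Dividing by
    [d] cannot turn any of them into a constant if the cancellations are made
    one factor at a time ([Omega_prod_div]), so the quotient keeps at least one
    irreducible factor for every irreducible factor of [f].  The argument for
    [g] is the same after exchanging the arguments of the resultant, which
    only changes its sign. *)

(** * Multiplicativity of the resultant *)

(** The matrix of the multiplication by [p] on F[X] / (q), in the basis of the
    powers of ['X]. *)
Definition modmulmx (F : fieldType) (q p : {poly F}) : 'M[F]_((size q).-1) :=
  lin1_mx (fun u => poly_rV ((rVpoly u * p) %% q)).

Lemma mul_modmulmx (F : fieldType) (q p : {poly F}) (u : 'rV_((size q).-1)) :
  u *m modmulmx q p = poly_rV ((rVpoly u * p) %% q).
Proof.
apply/rowP=> j; rewrite !mxE.
rewrite [rVpoly u]poly_def mulr_suml (big_morph _ (modpD q) (mod0p q)) coef_sum.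
apply: eq_bigr => i _; rewrite !mxE valK -scalerAl modpZl coefZ.
by rewrite rVpoly_delta.
Qed.

Lemma size_modp_pred (F : fieldType) (q p : {poly F}) :
  q != 0 -> (size (p %% q)%R <= (size q).-1)%N.
Proof. by move=> q0; rewrite -ltnS prednK ?ltn_modp // size_poly_gt0. Qed.

Lemma modmulmxM (F : fieldType) (q p1 p2 : {poly F}) :
  q != 0 -> modmulmx q (p1 * p2) = modmulmx q p1 *m modmulmx q p2.
Proof.
move=> q0; apply/row_matrixP => i; rewrite row_mul !rowE !mul_modmulmx.
by rewrite poly_rV_K ?size_modp_pred // [in RHS]mulrC modp_mul mulrA [in RHS]mulrC.
Qed.

(** Subtracting multiples of the rows [X^j q] from the rows [X^i p] of the
    Sylvester matrix replaces [X^i p] by its remainder modulo [q].  The matrix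
    becomes block lower triangular, with blocks the multiplication matrix and
    a triangular matrix with diagonal [lead_coef q]. *)
Lemma resultant_det_modmulmx (F : fieldType) (p q : {poly F}) :
  p != 0 -> q != 0 ->
  resultant p q = lead_coef q ^+ (size p).-1 * \det (modmulmx q p).
Proof.
move=> p0 q0; rewrite /resultant /Sylvester_mx.
set dq := (size q).-1; set dp := (size p).-1.
have sp : size p = dp.+1 by rewrite prednK // size_poly_gt0.
have sq : size q = dq.+1 by rewrite prednK // size_poly_gt0.
set P := lin1_mx _; set Q := lin1_mx _.
have mulP u : u *m P = poly_rV (rVpoly u * p).
  by rewrite mul_rV_lin1.
have mulQ u : u *m Q = poly_rV (rVpoly u * q).
  by rewrite mul_rV_lin1.
pose U : 'M[F]_(dq, dp) := \matrix_i poly_rV (('X^i * p) %/ q).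
have <- : \det (block_mx 1%:M (- U) 0 1%:M *m col_mx P Q) = \det (col_mx P Q).
  by rewrite det_mulmx det_ublock !det1 !mul1r.
rewrite mul_block_col !mul1mx mul0mx add0r.
(* The rows [X^i p - (X^i p %/ q) q] are the remainders of [X^i p]. *)
have -> : P + - U *m Q = row_mx (modmulmx q p) 0.
  apply/row_matrixP => i; rewrite linearD /= row_mul linearN /= mulNmx mulQ rowK.
  rewrite row_row_mx !rowE mul_modmulmx mulP rVpoly_delta mulmx0.
  rewrite poly_rV_K; last first.
    rewrite size_divp // size_monicM ?monicXn // size_polyXn sp addSn addnS /= -/dq.
    by rewrite leq_subLR -addSn leq_add2r.
  rewrite -linearB /= {1}[X in X - _](divp_eq ('X^i * p) q) addrC addKr.
  apply/rowP => j; rewrite !mxE; case: splitP => k ek; rewrite !mxE ek // nth_default //.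
  by apply: leq_trans (size_modp_pred _ q0) _; rewrite leq_addr.
rewrite -[Q in col_mx _ Q](hsubmxK Q) -/(block_mx _ _ _ _) det_lblock mulrC.
congr (_ * _); rewrite det_trig; last first.
  apply/is_trig_mxP => i j lt_ij; rewrite !mxE /= rVpoly_delta coefXnM.
  case: ltnP => // _; rewrite nth_default // sq.
  by rewrite -/dq ltn_subRL addnC ltn_add2l.
transitivity (\prod_(i < dp) lead_coef q); last first.
  by rewrite prodr_const card_ord.
apply: eq_bigr => i _; rewrite !mxE /= rVpoly_delta coefXnM.
by rewrite ltnNge leq_addl /= addnK lead_coefE.
Qed.

Lemma resultantMl_field (F : fieldType) (p1 p2 q : {poly F}) :
  p1 != 0 -> p2 != 0 -> q != 0 ->
  resultant (p1 * p2) q = resultant p1 q * resultant p2 q.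
Proof.
move=> p10 p20 q0; rewrite !resultant_det_modmulmx ?mulf_neq0 //.
rewrite modmulmxM // det_mulmx size_mul // mulrACA -exprD.
have : (0 < size p1)%N by rewrite size_poly_gt0.
have : (0 < size p2)%N by rewrite size_poly_gt0.
by case: (size p1) (size p2) => [|k] [|l] //; rewrite addSn addnS.
Qed.

(** The identity holds in the fraction field of the coefficient ring. *)
Lemma resultantMl (R : idomainType) (p1 p2 q : {poly {poly R}}) :
  p1 != 0 -> p2 != 0 -> q != 0 ->
  resultant (p1 * p2) q = resultant p1 q * resultant p2 q.
Proof.
move=> p10 p20 q0; apply/eqP; rewrite -tofrac_eq; apply/eqP.
have nzl (p : {poly {poly R}}) : p != 0 -> tofrac (lead_coef p) != 0.
  by move=> ?; rewrite tofrac_eq0 lead_coef_eq0.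
have nz (p : {poly {poly R}}) :
    p != 0 -> map_poly (@tofrac {poly R}) p != 0.
  by move=> p0; rewrite map_poly_eq0_id0 ?nzl.
rewrite rmorphM !map_resultant ?nzl ?mulf_neq0 // rmorphM.
by rewrite resultantMl_field ?nz.
Qed.

(** The two Sylvester matrices differ by the permutation that exchanges the two
    blocks of rows. *)
Lemma resultant_swap (R : idomainType) (p q : {poly R}) :
  exists b : bool, resultant q p = (-1) ^+ b * resultant p q.
Proof.
rewrite /resultant; set dp := (size p).-1; set dq := (size q).-1.
have e : (dp + dq = dq + dp)%N := addnC _ _.
have det_cast (k l : nat) (ekl : k = l) (N : 'M[R]_k) :
    \det (castmx (ekl, ekl) N) = \det N.
  by case: l / ekl; rewrite castmx_id.
pose swap (i : 'I_(dq + dp)) : 'I_(dq + dp) :=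
  match split (cast_ord (esym e) i) with
  | inl k => rshift dq k | inr k => lshift dp k end.
have swap_inj : injective swap.
  move=> i j; rewrite /swap => E; apply: (@cast_ord_inj _ _ (esym e)).
  apply: (can_inj (@splitK _ _)); move: E.
  case: (split _) => k; case: (split _) => l.
  - by move/rshift_inj ->.
  - by move/eqP; rewrite eq_rlshift.
  - by move/eqP; rewrite eq_lrshift.
  - by move/lshift_inj ->.
exists (odd_perm (perm swap_inj)).
rewrite -det_perm -det_mulmx -row_permE.
rewrite -(det_cast _ _ e) //; congr (\det _); apply/matrixP => i j.
rewrite castmxE [RHS]mxE permE !Sylvester_mxE /= /swap.
case: (split (cast_ord _ i)) => k.
  by rewrite -[rshift _ _]/(unsplit (inr k)) unsplitK.
by rewrite -[lshift _ _]/(unsplit (inl k)) unsplitK.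
Qed.

(** * Determinants with a dominant diagonal *)

Lemma degXM (K : fieldType) (p q : {poly K}) :
  p != 0 -> q != 0 -> degX (p * q) = degX p + degX q.
Proof.
move=> p0 q0; rewrite /degX size_mul //.
have : (0 < size p)%N by rewrite size_poly_gt0.
case: (size p) => // k _; rewrite addSn /= -addn1 !PoszD addrK.
by rewrite addrA.
Qed.

Lemma degX_prod (K : fieldType) (I : finType) (F : I -> {poly K}) :
  (forall i, F i != 0) -> degX (\prod_i F i) = \sum_i degX (F i).
Proof.
move=> F0; suff [] : \prod_i F i != 0 /\ degX (\prod_i F i) = \sum_i degX (F i) by [].
elim/big_ind2: _ => [|p k q l [p0 <-] [q0 <-]|i _].
- by rewrite oner_neq0 /degX size_poly1.
- by rewrite mulf_neq0 // degXM.
- by rewrite F0.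
Qed.

Lemma size_sum_dominant (K : nzRingType) (I : finType) (i0 : I) (F : I -> {poly K}) :
  F i0 != 0 ->
  (forall i, i != i0 -> size (F i) < size (F i0))%N ->
  size (\sum_i F i) = size (F i0).
Proof.
move=> F0 dom; rewrite (bigD1 i0) //= size_polyDl //.
apply: leq_ltn_trans (size_sum _ _ _) _; rewrite -ltnS.
rewrite -[X in (_ < X.+1)%N]prednK ?size_poly_gt0 // !ltnS.
apply/bigmax_leqP => i ne; rewrite -ltnS prednK ?size_poly_gt0 //.
exact: dom.
Qed.

Lemma size_lt_degX (K : fieldType) (p q : {poly K}) :
  q != 0 -> (p != 0 -> degX p < degX q) -> (size p < size q)%N.
Proof.
have [-> q0 _|p0 _ /(_ isT)] := eqVneq p 0.
  by rewrite size_poly0 size_poly_gt0.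
by rewrite /degX ltrD2r ltz_nat.
Qed.

(** Along a permutation [s], the weights [w * s i] of the columns add up to the
    same total as the weights [w * i] of the rows, so they drop out of the
    comparison between the term of [s] and the diagonal term in the Leibniz
    expansion: only the degrees are left. *)
Lemma det_dominant (K : fieldType) (N : nat) (M : 'M[{poly K}]_N) (w : rat) :
  (forall i, M i i != 0) ->
  (forall i j, j != i -> M i j != 0 ->
    (degX (M i j))%:~R + w * j%:R < (degX (M i i))%:~R + w * i%:R) ->
  \det M != 0 /\ degX (\det M) = \sum_i degX (M i i).
Proof.
move=> M0 dom.
have D0 : \prod_i M i i != 0 by apply/prodf_neq0.
suff sD : size (\det M) = size (\prod_i M i i).
  split; first by rewrite -size_poly_gt0 sD size_poly_gt0.
  by rewrite /degX sD -/(degX _) degX_prod.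
pose F (s : 'S_N) := (-1) ^+ s * \prod_i M i (s i).
have sF s : size (F s) = size (\prod_i M i (s i)).
  by rewrite /F mulr_sign; case: ifP; rewrite ?size_polyN.
have sF1 s : s = 1%g -> size (F s) = size (\prod_i M i i).
  by move=> ->; rewrite sF (eq_bigr (fun i => M i i)) // => i _; rewrite perm1.
rewrite /determinant (size_sum_dominant (i0 := 1%g : {perm _}) (F := F)) ?sF1 //.
  by rewrite -size_poly_gt0 sF1 // size_poly_gt0.
move=> s s1; rewrite sF; apply: size_lt_degX => // Fs0.
have Ms0 i : M i (s i) != 0 by move/prodf_neq0: Fs0; apply.
rewrite !degX_prod // -(ltr_int rat) !rmorph_sum /=.
(* Add the total of the weights on both sides, reindexed by [s] on the left. *)
rewrite -(ltrD2r (\sum_(i < N) w * (i : nat)%:R)).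
rewrite [X in _ + X < _](reindex_inj (@perm_inj _ s)) /= -!big_split /=.
have /existsP[i si] : [exists i, s i != i].
  apply: contraNT s1; rewrite negb_exists => /forallP fs.
  by apply/eqP/permP => i; rewrite perm1; apply/eqP; rewrite -[_ == _]negbK fs.
rewrite (bigD1 i) //= [X in _ < X](bigD1 i) //= ltr_leD ?dom //.
apply: ler_sum => k _; have [->|nk] := eqVneq (s k) k; first by [].
by rewrite ltW ?dom.
Qed.

(** * Dominant terms *)

Definition weight (K : fieldType) (w : rat) (p : {poly {poly K}}) (i : nat) : rat :=
  (degX p`_i)%:~R + w * i%:R.

Definition dominant (K : fieldType) (w : rat) (k : nat) (p : {poly {poly K}}) :=
  p`_k != 0 /\ forall i, i != k -> p`_i != 0 -> weight w p i < weight w p k.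

(** The diagonal of the Sylvester matrix carries the constant term of [p] on the
    rows of [p] and the leading coefficient of [q] on the rows of [q]; this is
    where the positions of the two dominant terms matter. *)
Lemma degX_resultant (K : fieldType) (w : rat) (p q : {poly {poly K}}) :
  dominant w 0 p -> dominant w (size q).-1 q ->
  resultant p q != 0 /\
  degX (resultant p q) =
    degX p`_0 *+ (size q).-1 + degX (lead_coef q) *+ (size p).-1.
Proof.
case=> p0 pdom [q0 qdom].
pose M := Sylvester_mx p q.
have MEl (i : 'I_((size q).-1)) j :
    M (lshift _ i) j = p`_(j - i) *+ (i <= j)%N.
  by rewrite /M Sylvester_mxE (unsplitK (inl i)).
have MEr (i : 'I_((size p).-1)) j :
    M (rshift _ i) j = q`_(j - i) *+ (i <= j)%N.
  by rewrite /M Sylvester_mxE (unsplitK (inr i)).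
have dl i : M (lshift _ i) (lshift _ i) = p`_0.
  by rewrite MEl /= leqnn subnn.
have dr i : M (rshift _ i) (rshift _ i) = lead_coef q.
  by rewrite MEr /= leq_addl addnK.
have [] := @det_dominant _ _ M w.
- move=> i; rewrite -(splitK i); case: (split i) => k /=; rewrite ?dl ?dr //.
- move=> i j; rewrite -(splitK i); case: (split i) => k /=.
    move=> ne; rewrite dl MEl; case: leqP => [le_kj|]; last by rewrite eqxx.
    move=> nz; have ne0 : (j - k != 0)%N.
      rewrite subn_eq0 -ltnNge ltn_neqAle le_kj andbT eq_sym.
      by apply: contra ne => /eqP e; apply/eqP/val_inj.
    have := pdom _ ne0 nz; rewrite /weight -(ltrD2r (w * k%:R)) mulr0 addr0.
    by rewrite -addrA -mulrDr -natrD subnK.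
  move=> ne; rewrite dr MEr; case: leqP => [le_kj|];  last by rewrite eqxx.
  move=> nz; have neq : (j - k != (size q).-1)%N.
    apply: contra ne => /eqP e; apply/eqP/val_inj => /=.
    by rewrite -[LHS](subnK le_kj) e.
  have := qdom _ neq nz; rewrite /weight -(ltrD2r (w * k%:R)) -!addrA -!mulrDr.
  by rewrite -!natrD subnK.
move=> n0 E; split; first exact: n0.
rewrite /resultant -/M E big_split_ord /=.
under eq_bigr do rewrite dl; under [X in _ + X = _]eq_bigr do rewrite dr.
by rewrite !sumr_const !card_ord.
Qed.

Lemma degX_resultant_ge (K : fieldType) (w : rat) (p q : {poly {poly K}}) :
  dominant w 0 p -> dominant w (size q).-1 q ->
  [/\ resultant p q != 0,
      (1 < size p)%N -> degX (lead_coef q) <= degX (resultant p q) &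
      (1 < size q)%N -> degX p`_0 <= degX (resultant p q)].
Proof.
have degX_ge0 (c : {poly K}) : c != 0 -> 0 <= degX c.
  by rewrite -size_poly_gt0 /degX subr_ge0.
move=> pdom qdom; have [R0 ->] := degX_resultant pdom qdom.
have p0 := degX_ge0 _ pdom.1; have q0 := degX_ge0 _ qdom.1.
split=> //.
  case: (size p) => [|[|k]] // _; rewrite /= mulrS addrCA lerDl.
  by rewrite addr_ge0 ?mulrn_wge0.
case: (size q) => [|[|k]] // _; rewrite /= mulrS -addrA lerDl.
by rewrite addr_ge0 ?mulrn_wge0.
Qed.

Lemma weight_coefM_le (K : fieldType) (w : rat) (p q : {poly {poly K}}) k :
  (p * q)`_k != 0 ->
  exists i j : nat, [/\ (i + j = k)%N, p`_i != 0, q`_j != 0 &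
                  weight w (p * q) k <= weight w p i + weight w q j].
Proof.
move=> nz; pose F (i : 'I_k.+1) := p`_i * q`_(k - i).
have [i le_i] : exists i : 'I_k.+1, (size ((p * q)`_k)%R <= size (F i))%N.
  apply/existsP; rewrite -[[exists _, _]]negbK negb_exists; apply/negP.
  move=> /forallP lt_F; have := size_sum (index_enum 'I_k.+1) xpredT F.
  rewrite -[\sum_(i | _) _]coefM leqNgt => /negP; apply.
  rewrite -(prednK (n := size ((p * q)`_k)%R)) ?size_poly_gt0 // ltnS.
  apply/bigmax_leqP => i _; rewrite -ltnS prednK ?size_poly_gt0 //.
  by rewrite ltnNge lt_F.
have : F i != 0 by rewrite -size_poly_gt0 (leq_trans _ le_i) // size_poly_gt0.
rewrite mulf_eq0 negb_or => /andP[pi qi].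
have le_ik : (i <= k)%N by rewrite -ltnS.
exists i, (k - i)%N; split=> //; first by rewrite subnKC.
rewrite /weight addrACA -mulrDr -natrD subnKC // lerD2r -rmorphD ler_int.
by rewrite -degXM // lerD2r lez_nat.
Qed.

(** No cancellation occurs in a coefficient of a product when one of the
    contributions to it has strictly larger weight than the others. *)
Lemma weight_coefM (K : fieldType) (w : rat) (p q : {poly {poly K}}) (i0 j0 : nat) :
  p`_i0 != 0 -> q`_j0 != 0 ->
  (forall i j : nat, (i + j = i0 + j0)%N -> i != i0 -> p`_i != 0 -> q`_j != 0 ->
     weight w p i + weight w q j < weight w p i0 + weight w q j0) ->
  (p * q)`_(i0 + j0) != 0 /\
  weight w (p * q) (i0 + j0) = weight w p i0 + weight w q j0.
Proof.
move=> p0 q0 dom; pose k := (i0 + j0)%N; rewrite -/k.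
have lt_i0 : (i0 < k.+1)%N by rewrite ltnS leq_addr.
pose F (i : 'I_k.+1) := p`_i * q`_(k - i).
have Fi0 : F (Ordinal lt_i0) = p`_i0 * q`_j0 by rewrite /F /= /k addKn.
have F0 : F (Ordinal lt_i0) != 0 by rewrite Fi0 mulf_neq0.
have s_pq : size ((p * q)`_k)%R = size (p`_i0 * q`_j0).
  rewrite coefM -Fi0; apply: (size_sum_dominant (F := F)) => // i ne.
  apply: size_lt_degX => //; rewrite mulf_eq0 negb_or => /andP[pi qi].
  rewrite Fi0 !degXM //.
  have le_ik : (i <= k)%N by rewrite -ltnS.
  have := dom _ _ (subnKC le_ik) ne pi qi.
  rewrite /weight addrACA -mulrDr -natrD subnKC // [X in _ < X]addrACA -mulrDr.
  by rewrite -natrD -/k ltrD2r -!rmorphD ltr_int.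
split; first by rewrite -size_poly_gt0 s_pq size_poly_gt0 -Fi0.
by rewrite /weight addrACA -mulrDr -natrD -/k -rmorphD -degXM // /degX s_pq.
Qed.

(** The abscissas [i1 <= i2] of the two ends of the edge of slope [-w] of the
    Newton polygon of [p]. *)
Lemma extremal_indices (K : fieldType) (w : rat) (p : {poly {poly K}}) :
  p != 0 -> exists (W : rat) (i1 i2 : nat),
  [/\ (forall i, p`_i != 0 -> weight w p i <= W),
      [/\ p`_i1 != 0, weight w p i1 = W &
          forall i, p`_i != 0 -> weight w p i = W -> (i1 <= i)%N] &
      [/\ p`_i2 != 0, weight w p i2 = W &
          forall i, p`_i != 0 -> weight w p i = W -> (i <= i2)%N]].
Proof.
move=> p0; have sp : ((size p).-1 < size p)%N by rewrite prednK // size_poly_gt0.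
pose P (i : 'I_(size p)) := p`_i != 0.
have P0 : P (Ordinal sp) by rewrite /P -lead_coefE lead_coef_eq0.
have lt_size i : p`_i != 0 -> (i < size p)%N.
  by move=> pi; rewrite ltnNge; apply: contra pi => ?; rewrite nth_default.
case: (@arg_maxP _ _ _ _ P (fun i => weight w p i) P0) => im Pm max_m.
pose W := weight w p im.
pose Q i := (p`_i != 0) && (weight w p i == W).
have exQ : exists i, Q i by exists (im : nat); rewrite /Q eqxx andbT.
have bdQ i : Q i -> (i <= size p)%N by case/andP=> /lt_size/ltnW.
exists W; case: (ex_minnP exQ) => i1 /andP[p1 /eqP W1] min1.
exists i1; case: (ex_maxnP exQ bdQ) => i2 /andP[p2 /eqP W2] max2.
exists i2; split.
- by move=> i pi; apply: (max_m (Ordinal (lt_size _ pi))).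
- by split=> // i pi /eqP Wi; apply: min1; rewrite /Q pi.
- by split=> // i pi /eqP Wi; apply: max2; rewrite /Q pi.
Qed.

(** Both ends of the edges of [p] and [q] produce, without cancellation, terms
    of maximal weight of [p * q].  Dominance at [k] forces them to have the same
    index [k], so the edges of [p] and [q] are reduced to points. *)
Lemma dominant_factor (K : fieldType) (w : rat) k (p q : {poly {poly K}}) :
  dominant w k (p * q) ->
  exists i j : nat, [/\ (i + j = k)%N, dominant w i p & dominant w j q].
Proof.
move=> [pqk dom]; have : p * q != 0 by apply: contraNneq pqk => ->; rewrite coef0.
rewrite mulf_eq0 negb_or => /andP[p0 q0].
have [W [i1 [i2 [leW [pi1 Wi1 min1] [pi2 Wi2 max2]]]]] := extremal_indices w p0.
have [V [j1 [j2 [leV [qj1 Vj1 min1'] [qj2 Vj2 max2']]]]] := extremal_indices w q0.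
have [c1 wc1] : (p * q)`_(i1 + j1) != 0 /\ weight w (p * q) (i1 + j1) = W + V.
  rewrite -Wi1 -Vj1; apply: weight_coefM => // i j e ne pi qj; rewrite Wi1 Vj1.
  have [lt_i|] := ltP (weight w p i) W; first by rewrite ltr_leD ?leV.
  move=> geW; have /min1 le_i : weight w p i = W by apply/le_anti; rewrite leW.
  rewrite ler_ltD ?leW // lt_neqAle leV // andbT.
  apply: contra ne => /eqP/(min1' _ qj) le_j.
  by rewrite eqn_leq le_i // andbT -(leq_add2r j) e leq_add2l.
have [c2 wc2] : (p * q)`_(i2 + j2) != 0 /\ weight w (p * q) (i2 + j2) = W + V.
  rewrite -Wi2 -Vj2; apply: weight_coefM => // i j e ne pi qj; rewrite Wi2 Vj2.
  have [lt_i|] := ltP (weight w p i) W; first by rewrite ltr_leD ?leV.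
  move=> geW; have /max2 le_i : weight w p i = W by apply/le_anti; rewrite leW.
  rewrite ler_ltD ?leW // lt_neqAle leV // andbT.
  apply: contra ne => /eqP/(max2' _ qj) le_j.
  by rewrite eqn_leq le_i //= -(leq_add2r j) e leq_add2l.
have le_k : weight w (p * q) k <= W + V.
  have [i [j [_ pi qj le_ij]]] := weight_coefM_le w pqk.
  by apply: le_trans le_ij _; rewrite lerD ?leW ?leV.
have e1 : (i1 + j1 = k)%N.
  by apply/eqP; apply: contraTT le_k => ne; rewrite -ltNge -wc1 dom.
have e2 : (i2 + j2 = k)%N.
  by apply/eqP; apply: contraTT le_k => ne; rewrite -ltNge -wc2 dom.
have le_i : (i1 <= i2)%N by apply: max2.
have le_j : (j1 <= j2)%N by apply: max2'.
have ei : i1 = i2.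
  by apply/eqP; rewrite eqn_leq le_i -(leq_add2r j2) e2 -e1 leq_add2l.
have ej : j1 = j2 by apply/eqP; rewrite -(eqn_add2l i1) {2}ei e2 e1.
exists i1, j1; split=> //; split=> // i ne nz; rewrite (Wi1, Vj1) lt_neqAle.
  rewrite leW // andbT; apply: contra ne => /eqP Wi.
  by rewrite eqn_leq min1 // andbT ei max2.
rewrite leV // andbT; apply: contra ne => /eqP Vi.
by rewrite eqn_leq min1' // andbT ej max2'.
Qed.

Lemma dominant0_factor (K : fieldType) (w : rat) (p q : {poly {poly K}}) :
  dominant w 0 (p * q) -> dominant w 0 p.
Proof.
by case/dominant_factor=> i [j [/eqP]]; rewrite addn_eq0 => /andP[/eqP-> _].
Qed.

Lemma dominant_lead_factor (K : fieldType) (w : rat) (p q : {poly {poly K}}) :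
  dominant w (size (p * q)).-1 (p * q) -> dominant w (size p).-1 p.
Proof.
case/dominant_factor=> i [j [e dp dq]].
have [i0 j0] : (i < size p /\ j < size q)%N.
  by split; rewrite ltnNge; [have := dp.1 | have := dq.1];
    apply: contra => ?; rewrite nth_default.
have p0 : p != 0 by rewrite -size_poly_gt0 (leq_trans _ i0).
have q0 : q != 0 by rewrite -size_poly_gt0 (leq_trans _ j0).
suff -> : (size p).-1 = i by [].
move: e; rewrite size_mul //; case: (size p) (size q) i0 j0 => [|k] [|l] //.
rewrite addSn addnS /= !ltnS => le_i le_j e; apply/eqP.
by rewrite eqn_leq le_i andbT -(leq_add2r l) -e leq_add2l.
Qed.

(** * Counting irreducible factors of a quotient *)

Lemma Omega_eqp (K : fieldType) (u v : {poly K}) : u %= v -> Omega u = Omega v.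
Proof.
move=> uv; have [u0|u0] := eqVneq u 0.
  by move: uv; rewrite u0 eqp_sym eqp0 => /eqP->.
have [s us] := irreducible_decomp_exists u0; rewrite (OmegaE us).
by apply/esym/OmegaE; split; [exact: us.1 | rewrite -(eqp_ltrans uv) us.2].
Qed.

Lemma OmegaM (K : fieldType) (u v : {poly K}) :
  u != 0 -> v != 0 -> Omega (u * v) = (Omega u + Omega v)%N.
Proof.
move=> /irreducible_decomp_exists[s us] /irreducible_decomp_exists[t vt].
rewrite (OmegaE us) (OmegaE vt) -size_cat; apply: OmegaE; split=> [p|].
  by rewrite mem_cat => /orP[/us.1|/vt.1].
by rewrite big_cat (eqp_trans (eqp_mulr _ us.2)) // eqp_mull // vt.2.
Qed.

Lemma Omega_gt0 (K : fieldType) (u : {poly K}) :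
  (1 < size u)%N -> (0 < Omega u)%N.
Proof.
move=> u1; have u0 : u != 0 by rewrite -size_poly_gt0 ltnW.
have [s us] := irreducible_decomp_exists u0; rewrite (OmegaE us).
case: s us => [[_]|//]; rewrite big_nil -size_poly_eq1 => /eqP su.
by rewrite su in u1.
Qed.

(** Let [c] be the gcd of [d] and the first factor [r].  Then [r / c] is not
    constant, since [deg c <= deg d < deg r], and it is coprime to [d / c],
    which therefore divides the product of the other factors: the first factor
    leaves at least one irreducible factor in the quotient, and [d / c], of
    degree at most [deg d], is left for the others. *)
Lemma Omega_prod_div (K : fieldType) (s : seq {poly K}) (d : {poly K}) :
  {in s, forall r : {poly K}, r != 0 /\ (size d < size r)%N} ->
  d %| \prod_(r <- s) r ->
  (size s <= Omega (\prod_(r <- s) r %/ d))%N.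
Proof.
elim: s d => [//|r s IHs] d sP; rewrite big_cons; set P := \prod_(_ <- s) _.
have [r0 lt_dr] := sP r (mem_head _ _).
have P0 : P != 0.
  rewrite /P prodf_seq_neq0; apply/allP => q qs; apply/implyP => _.
  by have [] := sP q; rewrite // inE qs orbT.
move=> d_dv; have d0 : d != 0.
  by apply: contraTneq d_dv => ->; rewrite dvd0p mulf_neq0.
pose c := gcdp d r; pose e := d %/ c; pose t := r %/ c.
have Ed : d = e * c by rewrite divpK // dvdp_gcdl.
have Er : r = t * c by rewrite divpK // dvdp_gcdr.
have : e * c != 0 by rewrite -Ed.
rewrite mulf_eq0 negb_or => /andP[e0 c0].
have t0 : t != 0 by apply: contraNneq r0 => t0; rewrite Er t0 mul0r.
have le_cd : (size c <= size d)%N by rewrite dvdp_leq // dvdp_gcdl.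
have t1 : (1 < size t)%N.
  rewrite size_divp // -(prednK (n := size c)) ?size_poly_gt0 //=.
  rewrite ltn_subRL addn1 prednK ?size_poly_gt0 //.
  exact: leq_ltn_trans le_cd lt_dr.
have co_et : coprimep e t by rewrite coprimep_div_gcd // d0.
have e_dv : e %| P.
  rewrite -(Gauss_dvdpr _ co_et) -(dvdp_mul2r _ _ c0) -Ed.
  by rewrite mulrAC -Er.
have -> : (r * P) %/ d = t * (P %/ e).
  rewrite -[RHS](mulpK _ d0); congr (_ %/ d).
  by rewrite [in RHS]Ed mulrA -(mulrA t) divpK // mulrAC -Er.
have Pe0 : P %/ e != 0 by apply: contraNneq P0 => z; rewrite -(divpK e_dv) z mul0r.
rewrite OmegaM //.
rewrite /= -add1n leq_add ?Omega_gt0 // IHs // => q qs.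
have := sP q; rewrite inE qs orbT => /(_ isT) [q0 lt_q].
split=> //; apply: leq_ltn_trans lt_q; rewrite dvdp_leq //.
by rewrite Ed dvdp_mulr.
Qed.

(** * Factorizations in K[X,Y] *)

Lemma factor_nonconstant (K : fieldType) (f u v : {poly {poly K}}) :
  no_nonconstant_factor_KX f -> f = u * v -> u != 0 ->
  u \isn't a GRing.unit -> (1 < size u)%N.
Proof.
move=> fX Ef u0; apply: contraNT; rewrite -leqNgt => /size1_polyC Eu.
have c0 : u`_0 != 0 by apply: contraNneq u0 => c0; rewrite Eu c0.
rewrite Eu rmorph_unit // poly_unitE unitfE.
have := fX u`_0 v; rewrite -Eu => /(_ Ef) /size1_polyC Ec.
rewrite Ec size_polyC coefC /=.
by rewrite Ec polyC_eq0 in c0; rewrite c0.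
Qed.

(** Both factors of a nontrivial factorization have positive degree in [Y], by
    [factor_nonconstant], so the degree in [Y] decreases. *)
Lemma irreducible_factorization (K : fieldType) (f : {poly {poly K}}) :
  no_nonconstant_factor_KX f -> f != 0 -> f \isn't a GRing.unit ->
  exists2 s : seq {poly {poly K}},
    {in s, forall p, irreducible_elt p} & f = \prod_(p <- s) p.
Proof.
have [k] := ubnP (size f); elim: k f => // k IHk f /ltnSE le_k fX f0 fU.
have [irr|red] := boolp.pselect (irreducible_elt f).
  by exists [:: f] => [p|]; rewrite ?big_seq1 // inE => /eqP ->.
have [u [v [Ef uU vU]]] : exists u v : {poly {poly K}},
    [/\ f = u * v, u \isn't a GRing.unit & v \isn't a GRing.unit].
  apply: boolp.contrapT => no_uv; apply: red; split=> // u v Ef.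
  have [|uU] := boolP (u \is a GRing.unit); first by left.
  have [|vU] := boolP (v \is a GRing.unit); first by right.
  by case: no_uv; exists u, v.
have : u * v != 0 by rewrite -Ef.
rewrite mulf_eq0 negb_or => /andP[u0 v0].
have u1 := factor_nonconstant fX Ef u0 uU.
have v1 : (1 < size v)%N by apply: (factor_nonconstant (v := u) fX); rewrite // mulrC.
have sf : size f = (size u + size v).-1 by rewrite Ef size_mul.
have [s sI Es] : exists2 s : seq {poly {poly K}},
    {in s, forall p, irreducible_elt p} & u = \prod_(p <- s) p.
  apply: IHk => //; last by move=> c q E; apply: (fX c (q * v)); rewrite mulrA -E.
  by apply: leq_trans le_k; rewrite sf ltn_predRL -addn1 ltn_add2l.
have [t tI Et] : exists2 t : seq {poly {poly K}},
    {in t, forall p, irreducible_elt p} & v = \prod_(p <- t) p.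
  apply: IHk => //; last by move=> c q E; apply: (fX c (q * u)); rewrite mulrA -E mulrC.
  by apply: leq_trans le_k; rewrite sf ltn_predRL -[(size v).+1]add1n ltn_add2r.
exists (s ++ t); last by rewrite big_cat /= -Es -Et.
by move=> p; rewrite mem_cat => /orP[/sI|/tI].
Qed.

Lemma resultant_prod (R : idomainType) (s : seq {poly {poly R}}) (q : {poly {poly R}}) :
  q != 0 -> {in s, forall p, p != 0} ->
  resultant (\prod_(p <- s) p) q = \prod_(p <- s) resultant p q.
Proof.
move=> q0; elim: s => [|p s IHs] sP.
  (* [Res(1, q)] is nonzero and equal to its own square. *)
  rewrite !big_nil; have R1 := resultantMl (oner_neq0 _) (oner_neq0 _) q0.
  have : resultant 1 q != 0.
    by rewrite resultant_eq0 (eqp_size (gcd1p _)) size_poly1.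
  by move=> nz; apply: (mulfI nz); rewrite -R1 !mulr1.
have p0 := sP p (mem_head _ _).
have sP' : {in s, forall r, r != 0}.
  by move=> r rs; apply: sP; rewrite inE rs orbT.
rewrite !big_cons resultantMl ?IHs // prodf_seq_neq0.
by apply/allP => r /sP'.
Qed.

Lemma factor_count (K : fieldType) (f g : {poly {poly K}}) (d : {poly K}) :
  no_nonconstant_factor_KX f -> (1 < size f)%N -> g != 0 ->
  (forall p q : {poly {poly K}}, f = p * q -> (1 < size p)%N ->
     resultant p g != 0 /\ (size d < size (resultant p g))%N) ->
  d %| resultant f g ->
  exists s : seq {poly {poly K}},
      [/\ {in s, forall p, irreducible_elt p},
          f = \prod_(p <- s) p &
          (size s <= Omega (resultant f g %/ d))%N].
Proof.
move=> fX f1 g0 large d_dv.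
have f0 : f != 0 by rewrite -size_poly_gt0 ltnW.
have fU : f \isn't a GRing.unit.
  by rewrite poly_unitE negb_and neq_ltn f1 orbT.
have [s sI Ef] := irreducible_factorization fX f0 fU.
exists s; split=> //.
have s0 : {in s, forall p, p != 0} by move=> p /sI [].
have Er : resultant f g = \prod_(r <- [seq resultant p g | p <- s]) r.
  by rewrite big_map Ef resultant_prod.
rewrite Er in d_dv *; rewrite -(size_map (resultant^~ g)).
apply: Omega_prod_div d_dv.
move=> _ /mapP[p ps ->].
have Efp : f = p * \prod_(r <- rem p s) r.
  by rewrite Ef (perm_big _ (perm_to_rem ps)) big_cons.
have [p0 pU _] := sI p ps.
exact: large Efp (factor_nonconstant fX Efp p0 pU).
Qed.

(** * The slope *)

(** A linear function of [k] is bounded by its values at both ends of the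
    interval from [1] to [l]: this is why the hypothesis involves both [A] and
    [A / n], and both [B] and [B / m]. *)
Lemma mulrn_lt_between (w c : rat) (k l : nat) :
  (0 < k <= l)%N -> w < c -> w * l%:R < c -> w * k%:R < c.
Proof.
case/andP=> k0 le_kl wc wlc; have [w0|w0] := leP 0 w.
  by apply: le_lt_trans wlc; rewrite ler_wpM2l ?ler_nat.
by apply: le_lt_trans wc; rewrite ger_nMr // ler1n.
Qed.

Lemma dominant0_poly (K : fieldType) (n : nat) (a : nat -> {poly K})
    (w : rat) (M : int) :
  a 0%N != 0 -> (forall i, (0 < i <= n)%N -> degX (a i) <= M) ->
  w < (degX (a 0%N) - M)%:~R -> w * n%:R < (degX (a 0%N) - M)%:~R ->
  dominant w 0 (\poly_(i < n.+1) a i).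
Proof.
move=> a0 leM wA wnA; split=> [|i i0]; first by rewrite coef_poly.
rewrite /weight !coef_poly /= mulr0 addr0.
case: ltnP => [lt_i _|]; last by rewrite eqxx.
have i_n : (0 < i <= n)%N by rewrite lt0n i0 -ltnS.
rewrite addrC -ltrBrDr -rmorphB.
apply: lt_le_trans (mulrn_lt_between i_n wA wnA) _.
by rewrite ler_int lerD2l lerN2 leM.
Qed.

Lemma dominant_lead_poly (K : fieldType) (m : nat) (b : nat -> {poly K})
    (w : rat) (M : int) :
  b m != 0 -> (forall i, (i < m)%N -> degX (b i) <= M) ->
  (M - degX (b m))%:~R < w -> (M - degX (b m))%:~R < w * m%:R ->
  dominant w m (\poly_(i < m.+1) b i).
Proof.
move=> bm leM Bw Bwm; split=> [|i im]; first by rewrite coef_poly ltnSn.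
rewrite /weight !coef_poly ltnSn.
case: ltnP => [lt_i _|]; last by rewrite eqxx.
have {im}lt_im : (i < m)%N by rewrite ltn_neqAle im -ltnS.
(* The condition on [i] is that of [mulrn_lt_between] for [- w] at [m - i]. *)
have wi : - w * (m - i)%:R < - (M - degX (b m))%:~R.
  apply: (mulrn_lt_between (l := m)).
  - by rewrite subn_gt0 lt_im leq_subr.
  - by rewrite ltrN2.
  - by rewrite mulNr ltrN2.
have leMi : (degX (b i))%:~R <= M%:~R :> rat by rewrite ler_int leM.
move: wi; rewrite mulNr ltrN2 natrB 1?ltnW // mulrBr rmorphB /=.
by lra.
Qed.

Theorem theorem7p9 (K : fieldType) (n m : nat) (a b : nat -> {poly K})
    (f g : {poly {poly K}}) (A B : rat) (d : {poly K})
    (hn : (1 <= n)%N) (hm : (1 <= m)%N)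
    (hf : f = \sum_(0 <= i < n.+1) (a i)%:P * 'X^i)
    (hg : g = \sum_(0 <= i < m.+1) (b i)%:P * 'X^i)
    (hab : a 0%N * a n * b 0%N * b m != 0)
    (hfX : no_nonconstant_factor_KX f)
    (hgX : no_nonconstant_factor_KX g)
    (hA : A = (degX (a 0%N) -
               \big[Num.max/degX (0 : {poly K})]_(1 <= i < n.+1) degX (a i))%:~R)
    (hB : B = (\big[Num.max/degX (0 : {poly K})]_(0 <= i < m) degX (b i) -
               degX (b m))%:~R)
    (hAB : Num.max B (B / m%:R) < Num.min A (A / n%:R))
    (hd : d %| resultant f g)
    (hdeg : degX d < Num.min (degX (a 0%N)) (degX (b m))) :
  (exists s : seq {poly {poly K}},
      [/\ {in s, forall p, irreducible_elt p},
          f = \prod_(p <- s) p &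
          (size s <= Omega (resultant f g %/ d))%N]) /\
  (exists s : seq {poly {poly K}},
      [/\ {in s, forall p, irreducible_elt p},
          g = \prod_(p <- s) p &
          (size s <= Omega (resultant f g %/ d))%N]).
Proof.
have sum_polyE (c : nat -> {poly K}) k :
    \sum_(0 <= i < k.+1) (c i)%:P * 'X^i = \poly_(i < k.+1) c i.
  rewrite big_mkord poly_def; apply: eq_bigr => i _.
  by rewrite mul_polyC.
rewrite !{}sum_polyE in hf hg.
move: hab; rewrite !mulf_eq0 !negb_or => /andP[/andP[/andP[a0 an] b0] bm].
have sf : size f = n.+1 by rewrite hf size_poly_eq.
have sg : size g = m.+1 by rewrite hg size_poly_eq.
have f_0 : f`_0 = a 0%N by rewrite hf coef_poly.
have lg : lead_coef g = b m by rewrite lead_coefE sg hg coef_poly ltnSn.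
pose w : rat := (Num.max B (B / m%:R) + Num.min A (A / n%:R)) / 2%:R.
have [] := midf_lt hAB; rewrite -/w gt_max lt_min.
move=> /andP[Bw Bwm] /andP[wA wnA].
rewrite ltr_pdivlMr ?ltr0n // in wnA; rewrite ltr_pdivrMr ?ltr0n // in Bwm.
have fdom : dominant w 0 f.
  rewrite hA in wA wnA; rewrite hf; apply: dominant0_poly wA wnA => // i i_n.
  apply: (@le_bigmax_seq _ _ _ _ _ i xpredT (fun k => degX (a k))) => //.
  by rewrite mem_index_iota.
have gdom : dominant w m g.
  rewrite hB in Bw Bwm; rewrite hg; apply: dominant_lead_poly Bw Bwm => // i i_m.
  apply: (@le_bigmax_seq _ _ _ _ _ i xpredT (fun k => degX (b k))) => //.
  by rewrite mem_index_iota.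
have gdom' : dominant w (size g).-1 g by rewrite sg.
have f1 : (1 < size f)%N by rewrite sf.
have g1 : (1 < size g)%N by rewrite sg.
have f0 : f != 0 by rewrite -size_poly_gt0 sf.
have g0 : g != 0 by rewrite -size_poly_gt0 sg.
move: hdeg; rewrite lt_min => /andP[d_lt_a d_lt_b].
split.
  apply: factor_count => // p q Efp p1.
  have pdom : dominant w 0 p by apply: (dominant0_factor (q := q)); rewrite -Efp.
  have [R0 /(_ p1) le_b _] := degX_resultant_ge pdom gdom'.
  split=> //; apply: size_lt_degX => // _.
  by apply: lt_le_trans le_b; rewrite lg.
have swap_eqp (p q : {poly {poly K}}) : resultant q p %= resultant p q.
  have [c ->] := resultant_swap p q; rewrite mulr_sign.
  by case: c; rewrite ?eqpxx // -scaleN1r eqp_scale ?oppr_eq0 ?oner_eq0.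
have [p q Egp p1||s [sI Eg le_s]] := @factor_count K g f d hgX g1 f0.
- have pdom : dominant w (size p).-1 p.
    by apply: (dominant_lead_factor (q := q)); rewrite -Egp.
  have [R0 _ /(_ p1) le_a] := degX_resultant_ge fdom pdom.
  have Rpf : size (resultant p f) = size (resultant f p).
    exact/eqp_size/swap_eqp.
  rewrite -size_poly_gt0 Rpf size_poly_gt0; split=> //.
  by apply: size_lt_degX => // _; apply: lt_le_trans le_a; rewrite f_0.
- by rewrite (eqp_dvdr _ (swap_eqp _ _)).
exists s; split=> //; apply: leq_trans le_s _.
by rewrite (Omega_eqp (v := resultant f g %/ d)) // eqp_divl // swap_eqp.
Qed.
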